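(* Let $G$ be a $\Theta$-graph which is (up to isomorphism) neither $\Theta_{1,2,2}$ nor any of the graphs $\Theta_{p,p,q}$ with integers $2\leq p\leq 3$ and $p\leq q\leq p+2$. Then $\mathrm{edim}(G)=2$.
   Context: All graphs are finite, simple and connected. A $\Theta$-graph is a graph with precisely two vertices $u,v$ of degree $3$, all other vertices of degree $2$, in which $u$ and $v$ are joined by three internally vertex-disjoint paths. It is denoted $\Theta_{p,q,r}$ when these three paths have lengths (numbers of edges) $p\le q\le r$; since graphs are simple, $q\ge 2$. For vertices $x,y$ of a graph $G$, $d(x,y)$ is the length of a shortest path between them; for a vertex $x$ and an edge $e=yz$, $d(x,e)=\min\{d(x,y),d(x,z)\}$. A vertex $s$ distinguishes two edges $e,e'$ if $d(s,e)\neq d(s,e')$. A set $S\subseteq V(G)$ is an edge metric generator if every pair of distinct edges of $G$ is distinguished by some $s\in S$. The edge metric dimension $\mathrm{edim}(G)$ is the size of a smallest edge metric generator of $G$. *)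

(* Defs.v *)
From mathcomp Require Import all_boot.

Set Implicit Arguments.
Unset Strict Implicit.
Unset Printing Implicit Defensive.

Record graph := Graph {
  vertex :> finType;
  adj : rel vertex;
  adj_sym : symmetric adj;
  adj_irr : irreflexive adj;
  adj_connected : forall x y, connect adj x y
}.

Definition degree (G : graph) (x : G) : nat := #|[set y | adj x y]|.

(* The path with vertex sequence x :: p, from x to y; its length is size p. *)
Definition is_path (G : graph) (x y : G) (p : seq G) : bool :=
  [&& path (@adj G) x p, last x p == y & uniq (x :: p)].

Lemma has_path (G : graph) (x y : G) :
  exists n, [exists p : n.-tuple G, is_path x y p].
Proof.
have /connectP[p0 + ->] := adj_connected x y.
case/shortenP=> p p_path p_uniq _.
by exists (size p); apply/existsP; exists (in_tuple p); apply/and3P.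
Qed.

Definition dist (G : graph) (x y : G) : nat := ex_minn (has_path x y).

(* An edge is given by its two endpoints y, z (in either order). *)
Definition edge_dist (G : graph) (x y z : G) : nat :=
  minn (dist x y) (dist x z).

Definition distinguishes (G : graph) (s y z y' z' : G) : bool :=
  edge_dist s y z != edge_dist s y' z'.

Definition edge_metric_generator (G : graph) (S : {set G}) : bool :=
  [forall y : G, forall z : G, forall y' : G, forall z' : G,
    [&& adj y z, adj y' z' & [set y; z] != [set y'; z']] ==>
    [exists s in S, distinguishes s y z y' z']].

Lemma dist_eq0 (G : graph) (x y : G) : (dist x y == 0) = (x == y).
Proof.
rewrite /dist; case: ex_minnP => n /existsP[p /and3P[_ /eqP lastp _]] minn.
apply/eqP/eqP => [n0 | xy]; first by subst n; rewrite -lastp (tuple0 p).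
apply/eqP; rewrite -leqn0; apply: minn; apply/existsP; exists [tuple].
by rewrite /is_path /= xy eqxx.
Qed.

Lemma edge_dist_eq0 (G : graph) (x y z : G) :
  (edge_dist x y z == 0) = (x \in [set y; z]).
Proof.
rewrite in_set2 -!dist_eq0 /edge_dist.
by case: (dist x y) => [|m]; case: (dist x z) => [|n]; rewrite ?minnSS.
Qed.

Lemma has_edge_metric_generator (G : graph) :
  exists k, [exists S : {set G}, edge_metric_generator S && (#|S| == k)].
Proof.
exists #|[set: G]|; apply/existsP; exists setT; rewrite eqxx andbT.
apply/'forall_'forall_'forall_forallP => y z y' z'.
apply/implyP => /and3P[_ _]; apply: contraR => /exists_inPn ndist.
apply/eqP/setP => s; rewrite -!edge_dist_eq0.
by have := ndist s (in_setT s); rewrite /distinguishes negbK => /eqP ->.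
Qed.

Definition edim (G : graph) : nat := ex_minn (has_edge_metric_generator G).

Definition interior (G : graph) (x : G) (p : seq G) : seq G :=
  behead (belast x p).

(* The three u-v paths are required to be distinct: internal disjointness alone
   would allow repeating the path of length 1. *)
Definition is_Theta (G : graph) (p q r : nat) : Prop :=
  p <= q <= r /\
  exists u v : G,
    [/\ u != v, degree u = 3, degree v = 3,
        forall w : G, w != u -> w != v -> degree w = 2
      & exists P Q R : seq G,
        [/\ [&& is_path u v P, is_path u v Q & is_path u v R],
            [/\ size P = p, size Q = q & size R = r],
            uniq [:: P; Q; R]
          & [&& ~~ has (mem (interior u P)) (interior u Q),
                ~~ has (mem (interior u P)) (interior u R)
              & ~~ has (mem (interior u Q)) (interior u R)]]].

Definition Theta_graph (G : graph) : Prop := exists p q r, is_Theta G p q r.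

(* Main.v *)
Require Import Defs.
From mathcomp Require Import all_boot.
From mathcomp Require Import zify.

(** A single vertex [s] of a graph of minimum degree at least 2 is at distance 0
    from two of its edges, so no set of at most one vertex is an edge metric
    generator; hence [edim G >= 2] (lemma [edim_ge2]).

    For the upper bound, the vertices of a Theta-graph with branch lengths
    p <= q <= r are written [X i t]: the vertex at position [t], counted from
    [u], on branch [i] (lemma [theta_coordsP]; the degree conditions and
    connectedness ensure that there are no other vertices and edges).
    A shortest path between two vertices either stays on a common branch or
    goes through [u] or [v], and a detour from [u] to [v] is best made along the
    shortest branch. This gives an explicit formula [theta_dist] for the
    distance (lemma [dist_theta]), in which the distance from a fixed vertex to
    the edge at position [t] of a branch is the smaller of two affine functions
    of [t] (a pair for each side of the vertex, on its own branch). Whether two given vertices distinguish all the edges is then a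
    question of linear arithmetic about [p], [q], [r] and the positions.

    The following pairs work, positions being counted from [u]:
    - the middle of the branch of length q and position 1 on the branch of
      length r, apart from the families below (lemma [resolving_mid_one]);
    - position p/2 on both the branch of length p and that of length r, when
      r = p + 2 and q is p, p + 1 or p + 2, with p >= 2 and, if q = p, p >= 4
      (lemma [resolving_half_half]);
    - position 1 on one branch of length p and position 2 on the other,
      when p = q >= 4 and r = p + 1 (lemma [resolving_one_two]);
    - positions 1 and 2 on the longest branch of the graph with branch lengths
      1, 2, 3 (lemma [resolving_123]).
    These cases exhaust the graphs that the theorem allows. *)

Set Implicit Arguments.
Unset Strict Implicit.
Unset Printing Implicit Defensive.

(** * Distances in a graph and bounds on the edge metric dimension *)

Section GraphDistance.
Variable G : graph.
Implicit Types x y z : G.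

Lemma dist_walk x (p : seq G) :
  path (@adj G) x p -> dist x (last x p) <= size p.
Proof.
case/shortenP=> p' p'_path p'_uniq p'_sub.
apply: leq_trans (uniq_leq_size _ p'_sub); last by case/andP: p'_uniq.
rewrite /dist; case: ex_minnP => n _; apply; apply/existsP.
by exists (in_tuple p'); apply/and3P.
Qed.

Lemma dist_realized x y :
  exists2 p : seq G, path (@adj G) x p & last x p = y /\ size p = dist x y.
Proof.
rewrite /dist; case: ex_minnP => n /existsP[p /and3P[p_path /eqP p_last _]] _.
by exists p => //; rewrite size_tuple.
Qed.

Lemma dist_triangle x y z : dist x z <= dist x y + dist y z.
Proof.
have [p p_path [py <-]] := dist_realized x y.
have [p' p'_path [p'z <-]] := dist_realized y z.
rewrite -size_cat -p'z -[in last y p']py -last_cat; apply: dist_walk.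
by rewrite cat_path p_path py.
Qed.

Lemma dist_adj x y : adj x y -> dist x y <= 1.
Proof. by move=> xy; apply: (@dist_walk x [:: y]); rewrite /= xy. Qed.

Lemma distxx x : dist x x = 0.
Proof. by apply/eqP; rewrite dist_eq0. Qed.

Lemma edge_distC (s y z : G) : edge_dist s y z = edge_dist s z y.
Proof. exact: minnC. Qed.

(** A generator with at most one element lies in some [[set s]], and [s] is at
    distance 0 from two edges. *)
Lemma edim_ge2 (x0 : G) : (forall x, 1 < degree x) -> 1 < edim G.
Proof.
move=> deg; rewrite /edim; case: ex_minnP => k /existsP[S /andP[S_gen /eqP Sk]] _.
rewrite -{}Sk ltnNge; apply/negP => S1.
have [s Ss] : exists s, {subset S <= [set s]}.
  have [->|[s sS]] := set_0Vmem S; first by exists x0 => y; rewrite in_set0.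
  by exists s => y yS; rewrite inE; apply/eqP/(card_le1_eqP S1).
have [y [z [sy sz yz]]] := card_gt1P (deg s).
move: sy sz; rewrite !inE => sy sz.
have /forallP/(_ s)/forallP/(_ y)/forallP/(_ s)/forallP/(_ z) := S_gen.
rewrite sy sz; case: (eqVneq [set s; y] [set s; z]) => /= [/setP/(_ y)|_].
  rewrite !inE eqxx orbT (negbTE yz) orbF => /esym/eqP ys.
  by rewrite ys adj_irr in sy.
case/exists_inP=> s' /Ss; rewrite inE => /eqP ->.
by rewrite /distinguishes /edge_dist distxx !min0n.
Qed.

Lemma edim_le2 (a b : G) :
  edge_metric_generator [set a; b] -> edim G <= 2.
Proof.
move=> ab; apply: leq_trans (_ : #|[set a; b]| <= 2).
  rewrite /edim; case: ex_minnP => k _; apply; apply/existsP; exists [set a; b].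
  by rewrite ab eqxx.
by rewrite cards2; case: (a != b).
Qed.

End GraphDistance.

(** * Coordinates on a Theta-graph *)

(** The indices of the branches of lengths p, q and r respectively. *)
Definition br0 : 'I_3 := @Ordinal 3 0 isT.
Definition br1 : 'I_3 := @Ordinal 3 1 isT.
Definition br2 : 'I_3 := @Ordinal 3 2 isT.

Lemma brP (i : 'I_3) : [\/ i = br0, i = br1 | i = br2].
Proof.
case: i => [[|[|[|m]]] lt3] //; [apply: Or31|apply: Or32|apply: Or33]; exact: val_inj.
Qed.

(** The length of branch [i]. *)
Definition theta_len (p q r : nat) (i : 'I_3) : nat := nth 0 [:: p; q; r] i.

(** [X i t] is the vertex at position [t] on branch [i], whose length is [l i];
    only positions [t <= l i] are meaningful. The branches share their first and
    last vertices, are otherwise disjoint, and carry all the edges of [G]. *)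
Record theta_coords (G : graph) (l : 'I_3 -> nat) (X : 'I_3 -> nat -> G) : Prop :=
  ThetaCoords {
  coord_start : forall i j, X i 0 = X j 0;
  coord_end : forall i j, X i (l i) = X j (l j);
  coord_inj : forall i j t t', t <= l i -> t' <= l j -> X i t = X j t' ->
    [\/ i = j /\ t = t', t = 0 /\ t' = 0 | t = l i /\ t' = l j];
  coord_adj : forall i t, t < l i -> adj (X i t) (X i t.+1);
  coord_edge : forall y z, adj y z -> exists i t, t < l i /\
    (y = X i t /\ z = X i t.+1 \/ y = X i t.+1 /\ z = X i t)
}.

(** From three [u]-[v] paths with interiors [T i] to coordinates. *)
Section Coordinates.
Variables (G : graph) (u v : G) (T : 'I_3 -> seq G).
Hypotheses (uv : u != v) (degu : degree u = 3) (degv : degree v = 3).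
Hypothesis degw : forall w : G, w != u -> w != v -> degree w = 2.
Hypothesis T_path : forall i, path (@adj G) u (rcons (T i) v).
Hypothesis T_uniq : forall i, uniq (u :: rcons (T i) v).
Hypothesis T_disj : forall i j, i != j -> ~~ has (mem (T i)) (T j).
Hypothesis T_inj : injective T.

Let l i := (size (T i)).+1.
Let X i t := nth v (u :: T i) t.

Let Xl i : X i (l i) = v.
Proof. by rewrite /X /l nth_default. Qed.

Let X_adj i t : t < l i -> adj (X i t) (X i t.+1).
Proof.
move=> tl; have /(pathP v)/(_ t) := T_path i.
by rewrite size_rcons -rcons_cons !nth_rcons_default => /(_ tl).
Qed.

Let X_in i t : 0 < t < l i -> X i t \in T i.
Proof. by case: t => //= t tl; rewrite /X /=; apply: mem_nth. Qed.

Let notinT i : (u \notin T i) /\ (v \notin T i).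
Proof.
have := T_uniq i; rewrite /= mem_rcons rcons_uniq inE negb_or.
by case/and3P => /andP[_ ->] ->.
Qed.

Let X_inj i j t t' : t <= l i -> t' <= l j -> X i t = X j t' ->
  [\/ i = j /\ t = t', t = 0 /\ t' = 0 | t = l i /\ t' = l j].
Proof.
have [ui vi] := notinT i; have [uj vj] := notinT j.
rewrite [t <= _]leq_eqVlt [t' <= _]leq_eqVlt.
case/predU1P=> [->|tl]; case/predU1P => [->|tl']; rewrite ?Xl.
- by move=> _; apply: Or33.
- case: t' tl' => [_ vu|t' tl' vE].
    by rewrite /X /= in vu; move: uv; rewrite vu eqxx.
  by have := X_in (tl' : 0 < t'.+1 < l j); rewrite -vE (negbTE vj).
- case: t tl => [_ vu|t tl vE].
    by rewrite /X /= in vu; move: uv; rewrite vu eqxx.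
  by have := X_in (tl : 0 < t.+1 < l i); rewrite vE (negbTE vi).
case: t tl => [|t] tl; case: t' tl' => [|t'] tl' E.
- exact: Or32.
- by have := X_in (tl' : 0 < t'.+1 < l j); rewrite -E (negbTE uj).
- by have := X_in (tl : 0 < t.+1 < l i); rewrite E (negbTE ui).
apply: Or31; have [ij|ij] := eqVneq i j; last first.
  case/hasP: (T_disj ij); exists (X j t'.+1); last by rewrite -E; apply: X_in.
  exact: X_in.
split=> //; move: E; rewrite -{}ij in tl' *; move/eqP.
rewrite nth_uniq //; first by move/eqP.
by have := T_uniq i; rewrite -rcons_cons rcons_uniq => /andP[].
Qed.

(* At most one of the branches is a single edge. *)
Let l_inj i j : l i = 1 -> l j = 1 -> i = j.
Proof. by move=> [/size0nil Ti] [/size0nil Tj]; apply: T_inj; rewrite Ti. Qed.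

(* The neighbours of a vertex on a branch that are given by its coordinates are
   distinct and as many as its degree, so there are no others. *)
Let X_edge i t z : t <= l i -> adj (X i t) z ->
  exists j t', t' < l j /\
    (X i t = X j t' /\ z = X j t'.+1 \/ X i t = X j t'.+1 /\ z = X j t').
Proof.
move=> tl tz; have {tz} : z \in [set y | adj (X i t) y] by rewrite inE.
have [t0|t_gt0] := posnP t.
  subst t; have -> : [set y | adj (X i 0) y] = [set X j 1 | j : 'I_3].
    apply/esym/eqP; rewrite eqEcard; apply/andP; split.
      by apply/subsetP => _ /imsetP[j _ ->]; rewrite inE (@X_adj j 0).
    rewrite -[#|pred_of_set [set y | _]|]/(degree u) degu card_imset ?card_ord //.
    move=> j k /X_inj-/(_ isT isT)[[]|[]|[/esym lj /esym lk]] //.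
    exact: l_inj.
  by case/imsetP=> j _ ->; exists j, 0; split=> //; left.
have [tE|tnl] := eqVneq t (l i).
  subst t; have -> : [set y | adj (X i (l i)) y] = [set X j (l j).-1 | j : 'I_3].
    apply/esym/eqP; rewrite eqEcard; apply/andP; split.
      apply/subsetP => _ /imsetP[j _ ->]; rewrite inE adj_sym Xl -(Xl j).
      exact: (@X_adj j (l j).-1).
    rewrite Xl -[#|pred_of_set [set y | _]|]/(degree v) degv card_imset ?card_ord //.
    move=> j k /X_inj-/(_ (leq_pred _) (leq_pred _)).
    case=> [[]//|[/= lj lk]|[/eqP]]; first by apply: l_inj; rewrite /l ?lj ?lk.
    by rewrite ltn_eqF /=.
  case/imsetP=> j _ ->; exists j, (l j).-1; split=> //; right.
  by rewrite !Xl; split=> //; rewrite -(Xl j).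
have {}tl : t < l i by rewrite ltn_neqAle tnl.
case: t t_gt0 tl {tnl} => // t _ tl.
have -> : [set y | adj (X i t.+1) y] = [set X i t; X i t.+2].
  apply/esym/eqP; rewrite eqEcard; apply/andP; split.
    apply/subsetP => y; rewrite !inE => /orP[] /eqP ->; last exact: X_adj.
    by rewrite adj_sym; apply: X_adj; apply: ltnW.
  have inT := X_in (tl : 0 < t.+1 < l i); have [ui vi] := notinT i.
  rewrite -[#|pred_of_set [set y | _]|]/(degree (X i t.+1)) degw.
  - rewrite cards2; case: eqVneq => // /X_inj-/(_ (ltnW (ltnW tl)) tl).
    by case=> [[_]|[]//|[]]; lia.
  - by apply: contraNneq ui => <-.
  - by apply: contraNneq vi => <-.
rewrite !inE => /orP[] /eqP ->.
  by exists i, t; split; [apply: ltnW | right].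
by exists i, t.+1; split=> //; left.
Qed.

Lemma theta_coords_paths : theta_coords l X.
Proof.
split=> //; first by move=> i j; rewrite !Xl.
move=> y z.
have [i [t [tl ->]]] : exists i t, t <= l i /\ y = X i t; last exact: X_edge.
have /connectP[s s_path ->] := adj_connected u y.
elim/last_ind: s s_path => [|s w IH]; first by exists ord0, 0.
rewrite rcons_path last_rcons => /andP[/IH[i [t [tl ->]]] /(X_edge tl)].
case=> j [t' [tl' [[_ ->]|[_ ->]]]]; first by exists j, t'.+1.
by exists j, t'; split=> //; apply: ltnW.
Qed.
End Coordinates.

Lemma interior_rcons (G : graph) (x y : G) (s : seq G) : interior x (rcons s y) = s.
Proof. by rewrite /interior belast_rcons. Qed.

Lemma theta_coordsP (G : graph) p q r :
  is_Theta G p q r ->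
  [/\ 0 < p, 1 < q & exists X : 'I_3 -> nat -> G, theta_coords (theta_len p q r) X].
Proof.
case=> [/andP[pq _] [u [v [uv du dv dw [P [Q [R [isP [sP sQ sR] PQR disj]]]]]]]].
have ends S : is_path u v S -> exists S', S = rcons S' v.
  case/and3P=> _; case/lastP: S => [|S w]; first by rewrite /= (negbTE uv).
  by rewrite last_rcons => /eqP -> _; exists S.
case/and3P: isP => isP isQ isR.
have [P' PE] := ends _ isP; have [Q' QE] := ends _ isQ; have [R' RE] := ends _ isR.
subst P Q R; move: disj; rewrite !interior_rcons => /and3P[PQ PR QR].
pose T (i : 'I_3) := nth [::] [:: P'; Q'; R'] i.
have T_is i : is_path u v (rcons (T i) v) by case: (brP i) => ->.
have TE i : (size (T i)).+1 = theta_len p q r i.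
  by rewrite -(size_rcons _ v); case: (brP i) => ->.
have T_inj : injective T.
  have : uniq [:: P'; Q'; R'].
    by rewrite -(map_inj_uniq (@rcons_injl _ v)).
  by move=> T_uniq i j /eqP; rewrite nth_uniq // => /eqP/val_inj.
have p_gt0 : 0 < p by rewrite -(TE br0 : _ = p).
split=> //.
  rewrite ltnNge; apply/negP => q1.
  have /size0nil T1 : size (T br1) = 0 by have : _ = q := TE br1; lia.
  have /size0nil T0 : size (T br0) = 0 by have : _ = p := TE br0; lia.
  by have := @T_inj br0 br1; rewrite T0 T1 => /(_ erefl).
exists (fun i t => nth v (u :: T i) t).
have [||||cs ce ci ca cd] := @theta_coords_paths G u v T uv du dv dw => //.
- by move=> i; case/and3P: (T_is i).
- by move=> i; case/and3P: (T_is i).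
- move=> i j; case: (brP i) => ->; case: (brP j) => -> // _; by rewrite /T //= has_sym.
split=> //.
- by move=> i j; rewrite -!TE.
- by move=> i j t t'; rewrite -!TE; apply: ci.
- by move=> i t; rewrite -TE; apply: ca.
- by move=> y z /cd[i [t [tl H]]]; exists i, t; rewrite -TE.
Qed.

(** * Distances in a Theta-graph *)

(** The distance from [X k c] to [X i t] when the branch lengths are
    p <= q <= r. Here [du] and [dv] are the distances from [X k c] to [u] and to
    [v]; each is reached directly along branch [k], or by going to the other
    end of [k] and then along the shortest branch. *)
Definition theta_dist (p q r : nat) (k : 'I_3) (c : nat) (i : 'I_3) (t : nat) : nat :=
  let l := theta_len p q r in
  let du := minn c (l k - c + p) in
  let dv := minn (l k - c) (c + p) in
  let d := minn (du + t) (dv + (l i - t)) in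
  if i == k then minn d ((t - c) + (c - t)) else d.

(** The distance from [X k c] to the edge between [X i t] and [X i t.+1]. *)
Definition theta_edge_dist p q r k c i t :=
  minn (theta_dist p q r k c i t) (theta_dist p q r k c i t.+1).

(** [X k c] and [X k' c'] together distinguish all the edges, an edge being given
    by its branch and the position of its end nearer to [u]. *)
Definition resolving p q r k c k' c' :=
  forall i j t t', t < theta_len p q r i -> t' < theta_len p q r j ->
  theta_edge_dist p q r k c i t = theta_edge_dist p q r k c j t' ->
  theta_edge_dist p q r k' c' i t = theta_edge_dist p q r k' c' j t' ->
  i = j /\ t = t'.

Section Distances.
Variables (G : graph) (p q r : nat) (X : 'I_3 -> nat -> G).
Hypotheses (p_gt0 : 0 < p) (pq : p <= q) (qr : q <= r).
Hypothesis X_coords : theta_coords (theta_len p q r) X.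
Notation l := (theta_len p q r).

Let l_min i : p <= l i.
Proof. by case: (brP i) => ->; rewrite /theta_len //= (leq_trans pq). Qed.

Lemma dist_along i a b : a <= l i -> b <= l i ->
  dist (X i a) (X i b) <= (a - b) + (b - a).
Proof.
have up n c : c + n <= l i ->
    dist (X i c) (X i (c + n)) <= n /\ dist (X i (c + n)) (X i c) <= n.
  elim: n => [|n IH] cn; first by rewrite addn0 distxx.
  rewrite addnS in cn *; have [IH1 IH2] := IH (ltnW cn).
  have adjc := coord_adj X_coords cn.
  have dS := dist_adj adjc; rewrite adj_sym in adjc; have dS' := dist_adj adjc.
  have := dist_triangle (X i c) (X i (c + n)) (X i (c + n).+1).
  have := dist_triangle (X i (c + n).+1) (X i (c + n)) (X i c).
  lia.
move=> ai bi; case: (leqP a b) => ab.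
  have [H _] := up (b - a) a (ltac:(lia)).
  by rewrite (eqP ab) -[in X i b](subnKC ab).
have [_ H] := up (a - b) b (ltac:(lia)).
by rewrite (eqP (ltnW ab)) addn0 -[in X i a](subnKC (ltnW ab)).
Qed.

Lemma theta_dist_start k c i : c <= l k ->
  theta_dist p q r k c i 0 = minn c (l k - c + p).
Proof.
move=> ck; have := l_min i; rewrite /theta_dist.
case: eqP => [->|_]; lia.
Qed.

Lemma theta_dist_end k c i : c <= l k ->
  theta_dist p q r k c i (l i) = minn (l k - c) (c + p).
Proof.
move=> ck; have := l_min i; rewrite /theta_dist.
case: eqP => [->|_]; lia.
Qed.

(** [theta_dist] depends only on the vertex [X i t], not on its coordinates. *)
Lemma theta_dist_consistent k c i j t t' : c <= l k -> t <= l i -> t' <= l j ->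
  X i t = X j t' -> theta_dist p q r k c i t = theta_dist p q r k c j t'.
Proof.
move=> ck ti tj /(coord_inj X_coords ti tj)[[-> ->]|[-> ->]|[-> ->]] //.
  by rewrite !theta_dist_start.
by rewrite !theta_dist_end.
Qed.

Lemma theta_distS k c i t : t < l i ->
  theta_dist p q r k c i t <= (theta_dist p q r k c i t.+1).+1 /\
  theta_dist p q r k c i t.+1 <= (theta_dist p q r k c i t).+1.
Proof.
rewrite /theta_dist; case: eqP => [->|_] ti; lia.
Qed.

(** The upper bound follows from the triangle inequality through [u] and [v],
    the lower bound from the fact that [theta_dist] varies by at most 1 along
    each edge. *)
Lemma dist_theta k c i t : c <= l k -> t <= l i ->
  dist (X k c) (X i t) = theta_dist p q r k c i t.
Proof.
move=> ck ti; apply/eqP; rewrite eqn_leq; apply/andP; split.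
- have toS a b : dist (X a 0) (X b (l b)) <= p.
    rewrite (coord_start X_coords a br0) (coord_end X_coords b br0).
    by have := @dist_along br0 0 (l br0) isT (leqnn _); rewrite sub0n subn0.
  have toE a b : dist (X a (l a)) (X b 0) <= p.
    rewrite (coord_start X_coords b br0) (coord_end X_coords a br0).
    by have := @dist_along br0 (l br0) 0 (leqnn _) isT; rewrite sub0n subn0 addn0.
  have D1 := dist_along ck (leq0n (l k)).
  have D2 := dist_along ck (leqnn (l k)).
  have D3 := dist_along (leq0n (l i)) ti.
  have D4 := dist_along (leqnn (l i)) ti.
  have D5 := dist_triangle (X k c) (X k 0) (X i t).
  have D6 := dist_triangle (X k c) (X k (l k)) (X i t).
  have D7 := dist_triangle (X k 0) (X i (l i)) (X i t).
  have D8 := dist_triangle (X k (l k)) (X i 0) (X i t).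
  have D9 : dist (X k 0) (X i t) <= t.
    by rewrite (coord_start X_coords k i); move: D3; rewrite sub0n subn0.
  have D10 : dist (X k (l k)) (X i t) <= l i - t.
    by rewrite (coord_end X_coords k i); move: D4; rewrite (eqP ti) addn0.
  have := toS k i; have := toE k i.
  rewrite /theta_dist; case: eqP => [ik|_]; last by lia.
  have := dist_along ck (_ : t <= l k); rewrite -{1}ik => /(_ ti).
  rewrite ik in D3 D4 D5 D6 D7 D8 D9 D10 *; lia.
- have [s s_path [sX <-]] := dist_realized (X k c) (X i t).
  elim/last_ind: s i t ti s_path sX => [|s w IH] i t ti.
    move=> _ /= /(theta_dist_consistent ck ck ti) <-.
    by rewrite /theta_dist eqxx subnn !addn0 minn0.
  rewrite rcons_path last_rcons size_rcons => /andP[s_path sw] wE.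
  have [j [t' [tj]]] := coord_edge X_coords sw.
  have [S1 S2] := theta_distS k c tj.
  case=> -[sE wE']; rewrite wE' in wE; rewrite -(theta_dist_consistent ck _ ti wE) //.
  - by apply: leq_trans S2 _; apply: IH => //; apply: ltnW.
  - by apply: leq_trans S1 _; apply: IH.
  - exact: ltnW.
Qed.

Lemma resolving_edim_le2 k c k' c' : c <= l k -> c' <= l k' ->
  resolving p q r k c k' c' -> edim G <= 2.
Proof.
move=> ck ck' res; apply: (@edim_le2 G (X k c) (X k' c')).
have edge y z : adj y z -> exists i t, t < l i /\ [set y; z] = [set X i t; X i t.+1]
   /\ forall s, edge_dist s y z = edge_dist s (X i t) (X i t.+1).
  case/(coord_edge X_coords)=> i [t [ti [[-> ->]|[-> ->]]]]; exists i, t; do !split=> //.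
    by rewrite setUC.
  by move=> s; apply: edge_distC.
apply/'forall_'forall_'forall_forallP => y z y' z'.
apply/implyP=> /and3P[/edge[i [t [ti [-> eE]]]] /edge[j [t' [tj [-> eE']]]]].
apply: contraR => /exists_inPn ndist.
have D a b : b <= l a -> X a b \in [set X k c; X k' c'] ->
    theta_edge_dist p q r a b i t = theta_edge_dist p q r a b j t'.
  move=> ba /ndist; rewrite /distinguishes negbK eE eE' /edge_dist => /eqP.
  by rewrite !dist_theta // ltnW.
have [||-> ->] := res i j t t' ti tj; rewrite ?eqxx //;
  by apply: D => //; rewrite !inE eqxx ?orbT.
Qed.

End Distances.

Lemma theta_degree (G : graph) p q r (x : G) : is_Theta G p q r -> 1 < degree x.
Proof.
case=> _ [u [v [_ du dv dw _]]].
have [->|xu] := eqVneq x u; first by rewrite du.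
have [->|xv] := eqVneq x v; first by rewrite dv.
by rewrite dw.
Qed.

(** * Pairs of vertices that distinguish all the edges *)

(** [edge_spec on c du dv t s e] says, without truncated subtraction, that [e] is
    the distance from a vertex at distances [du] and [dv] from [u] and [v] to the
    edge that has [t] edges before it and [s] edges after it on its branch. If
    [on] holds, the vertex is at position [c] of the same branch. The orders are
    the propositional ones, so that the disjunctions can be split and what
    remains is a conjunction of linear constraints. *)
Definition edge_spec (on : bool) (c du dv t s e : nat) : Prop :=
  if on then
    lt t c /\ (e + t.+1 = c /\ le c (du + t + t.+1) \/
               e = du + t /\ le (du + t + t.+1) c) \/
    le c t /\ (e + c = t /\ le t (dv + s + c) \/
               e = dv + s /\ le (dv + s + c) t)
  else e = du + t /\ le (du + t) (dv + s) \/ e = dv + s /\ le (dv + s) (du + t).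

Lemma theta_edge_distP p q r k c i t s (l := theta_len p q r) du dv :
  c <= l k -> t + s.+1 = l i ->
  du = minn c (l k - c + p) -> dv = minn (l k - c) (c + p) ->
  edge_spec (i == k) c du dv t s (theta_edge_dist p q r k c i t).
Proof.
move=> cl ts duE dvE; rewrite /theta_edge_dist /theta_dist -/l -duE -dvE.
have -> : l i - t = s.+1 by lia.
have -> : l i - t.+1 = s by lia.
rewrite /edge_spec; case: eqP => [ik|_]; last by clear; lia.
rewrite ik in ts; clear ik i; move: (l k) cl ts duE dvE => m; clear.
case: (leqP c t) => ct.
  move=> cl ts duE dvE; right; split; first exact/leP.
  have {}dvE : dv <= m - c by lia.
  rewrite (eqP ct) (eqP (leqW ct)) !addn0 subSn //.
  have {duE dvE ts} : t - c <= du + t by lia.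
  have {ct} : t = (t - c) + c by lia.
  move: (t - c) => x; lia.
move=> cl ts duE dvE; left; split; first exact/ltP.
have {duE dvE cl ts} : c - t <= dv + s.+1 by lia.
rewrite (eqP (ltnW ct)) (eqP ct) !add0n -(subnSK ct).
have {ct} : c = (c - t.+1) + t.+1 by lia.
move: (c - t.+1) => x; lia.
Qed.

(** By symmetry it is enough to compare the edges of branches [i <= j]. *)
Lemma resolving_suff p q r k c k' c' du dv du' dv' (l := theta_len p q r) :
  c <= l k -> c' <= l k' ->
  du = minn c (l k - c + p) -> dv = minn (l k - c) (c + p) ->
  du' = minn c' (l k' - c' + p) -> dv' = minn (l k' - c') (c' + p) ->
  (forall (i j : 'I_3) t s t' s' e e', i <= j -> t + s.+1 = l i -> t' + s'.+1 = l j ->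
     edge_spec (i == k) c du dv t s e -> edge_spec (j == k) c du dv t' s' e ->
     edge_spec (i == k') c' du' dv' t s e' -> edge_spec (j == k') c' du' dv' t' s' e' ->
     i = j /\ t = t') ->
  resolving p q r k c k' c'.
Proof.
move=> ck ck' duE dvE duE' dvE' H i j t t'.
wlog ij : i j t t' / i <= j.
  move=> W ti tj E1 E2; case/orP: (leq_total i j) => ij; first exact: W.
  by case: (W j i t' t ij tj ti) => // -> ->.
move=> ti tj E1 E2.
have tsi : t + (l i - t.+1).+1 = l i by rewrite /l; lia.
have tsj : t' + (l j - t'.+1).+1 = l j by rewrite /l; lia.
apply: (H _ _ _ _ _ _ _ _ ij tsi tsj (theta_edge_distP ck tsi duE dvE) _
  (theta_edge_distP ck' tsi duE' dvE')).
- by rewrite E1; apply: theta_edge_distP.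
- by rewrite E2; apply: theta_edge_distP.
Qed.

(* Splits the disjunctions nested in [H]. *)
Ltac split_or H :=
  lazymatch type of H with
  | _ \/ _ => destruct H as [H|H]; split_or H
  | _ /\ _ => let H' := fresh in destruct H as [H H']; split_or H; split_or H'
  | _ => idtac
  end.

(* Splits on the branches of the two edges and on the affine expressions that
   give their distances. If the branches agree, the positions have to be shown
   equal; otherwise the hypotheses are contradictory. *)
Ltac resolve_lia :=
  let i := fresh "i" in let j := fresh "j" in
  let m1 := fresh "m" in let m2 := fresh "m" in
  let m3 := fresh "m" in let m4 := fresh "m" in
  move=> i j ? ? ? ? ? ?; case: (brP i) => ->; case: (brP j) => ->;
  rewrite /theta_len //=; move=> _; clear i j;
  match goal with
  | |- context [?a = ?a /\ _] => move=> ? ? m1 m2 m3 m4; split=> //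
  | _ => move=> ? ? m1 m2 m3 m4; exfalso
  end;
  split_or m1; split_or m2; split_or m3; split_or m4; lia.

Lemma resolving_mid_one p q r : 0 < p -> p <= q -> q <= r -> 1 < q ->
  p <= 1 \/ r <> p + 2 /\ (p <> q \/ r <> p + 1) ->
  p <> 1 \/ q <> 2 \/ 4 <= r -> p <> r \/ 4 <= r ->
  resolving p q r br1 q./2 br2 1.
Proof.
move=> /leP p0 /leP pq /leP qr /leP q1 n1 n2 n3.
have {}n1 : le p 1 \/ r <> p + 2 /\ (p <> q \/ r <> p + 1) by lia.
have {}n2 : p <> 1 \/ q <> 2 \/ le 4 r by lia.
have {}n3 : p <> r \/ le 4 r by lia.
have [h [hE [g qE]]] :
    exists h, q./2 = h /\ exists g, q = h + g /\ (h = g \/ g = h.+1).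
  by exists q./2; split=> //; exists (q - q./2); lia.
case: qE => qE gE.
have dvE : minn (r - 1) (1 + p) + 1 = r /\ le r (2 + p) \/
           minn (r - 1) (1 + p) = 1 + p /\ le (2 + p) r by lia.
rewrite {}hE.
apply: (@resolving_suff _ _ _ _ _ _ _ h g 1 (minn (r - 1) (1 + p))).
1-6: rewrite /theta_len /=; lia.
move: (minn (r - 1) _) dvE => dv dvE.
case: gE => gE; case: dvE => [[dv1 dv2]|[dv1 dv2]]; resolve_lia.
Qed.

Lemma resolving_half_half p q r : 2 <= p -> r = p + 2 ->
  4 <= p /\ q = p \/ q = p.+1 \/ q = p.+2 ->
  resolving p q r br0 p./2 br2 p./2.
Proof.
move=> /leP p2 rE qE.
have {}qE : le 4 p /\ q = p \/ q = p.+1 \/ q = p.+2 by lia.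
have [h [hE [g pE]]] :
    exists h, p./2 = h /\ exists g, p = h + g /\ (h = g \/ g = h.+1).
  by exists p./2; split=> //; exists (p - p./2); lia.
case: pE => pE gE.
rewrite {}hE; apply: (@resolving_suff _ _ _ _ _ _ _ h g h g.+2).
1-6: rewrite /theta_len /=; lia.
subst r p.
resolve_lia.
Qed.

Lemma resolving_one_two p : 4 <= p -> resolving p p p.+1 br0 1 br1 2.
Proof.
move=> p4.
have [k pE] : exists k, p = k.+4 by exists (p - 4); lia.
subst p; apply: (@resolving_suff _ _ _ _ _ _ _ 1 k.+3 2 k.+2).
1-6: rewrite /theta_len /=; lia.
resolve_lia.
Qed.

Lemma resolving_123 : resolving 1 2 3 br2 1 br2 2.
Proof.
apply: (@resolving_suff _ _ _ _ _ _ _ 1 2 2 1) => //.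
resolve_lia.
Qed.

(** * The theorem *)

Theorem theorem17 (G : graph) (G_Theta : Theta_graph G)
    (G_not_122 : ~ is_Theta G 1 2 2)
    (G_not_ppq : forall p q : nat,
       2 <= p <= 3 -> p <= q <= p + 2 -> ~ is_Theta G p p q) :
  edim G = 2.
Proof.
have [p [q [r Gpqr]]] := G_Theta.
have [u _] := Gpqr.2.
have [/andP[pq qr] _] := Gpqr.
have [p_gt0 q_gt1 [X XP]] := theta_coordsP Gpqr.
apply/eqP; rewrite eqn_leq (edim_ge2 u) ?andbT; last first.
  by move=> x; apply: theta_degree Gpqr.
have not122 : ~ [/\ p = 1, q = 2 & r = 2].
  by case=> p1 q2 r2; rewrite p1 q2 r2 in Gpqr.
have notppq : p = q -> 2 <= p <= 3 -> p + 2 < r.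
  move=> pqE p23; rewrite ltnNge; apply/negP => rp; rewrite -pqE in Gpqr qr.
  by apply: (G_not_ppq p r); rewrite ?qr.
have le2 := resolving_edim_le2 p_gt0 pq qr XP.
have : [\/ [/\ p = 1, q = 2 & r = 3],
  [/\ q = p, r = p.+1 & 4 <= p],
  [/\ 2 <= p, r = p + 2 & 4 <= p /\ q = p \/ q = p.+1 \/ q = p.+2]
| [/\ p <= 1 \/ r <> p + 2 /\ (p <> q \/ r <> p + 1),
      p <> 1 \/ q <> 2 \/ 4 <= r & p <> r \/ 4 <= r]].
  have n122 : p <> 1 \/ q <> 2 \/ r <> 2.
    case: (p =P 1) (q =P 2) (r =P 2) not122 => [->|?] [->|?] [->|?] n; auto.
    by case: n.
  have nppq : p <> q \/ p <= 1 \/ 4 <= p \/ p + 2 < r by lia.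
  clear - p_gt0 q_gt1 pq qr n122 nppq.
  have : (p = 1 /\ q = 2 /\ r = 3) \/ (q = p /\ r = p.+1 /\ 4 <= p) \/
    (2 <= p /\ r = p + 2 /\ (4 <= p /\ q = p \/ q = p.+1 \/ q = p.+2)) \/
    ((p <= 1 \/ r <> p + 2 /\ (p <> q \/ r <> p + 1)) /\
      (p <> 1 \/ q <> 2 \/ 4 <= r) /\ (p <> r \/ 4 <= r)) by lia.
  by case=> [[? []]|[[? []]|[[? []]|[? []]]]] *;
    [apply: Or41|apply: Or42|apply: Or43|apply: Or44].
case=> [[pE qE rE]|[qE rE p4]|[p2 rE qE]|[c1 c2 c3]].
- by subst p q r; apply: (le2 _ _ _ _ _ _ resolving_123).
- subst q r; apply: (le2 _ _ _ _ _ _ (resolving_one_two p4)).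
  + by rewrite /theta_len /=; lia.
  + by rewrite /theta_len /=; lia.
- apply: (le2 _ _ _ _ _ _ (resolving_half_half p2 rE qE)).
  + by rewrite /theta_len /=; lia.
  + by rewrite /theta_len /=; lia.
- apply: (le2 _ _ _ _ _ _ (resolving_mid_one p_gt0 pq qr q_gt1 c1 c2 c3)).
  + by rewrite /theta_len /=; lia.
  + by rewrite /theta_len /=; lia.
Qed.
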